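(* Let $\mathcal I$ be an ideal on $\kappa$ extending the bounded ideal. If the dual filter $\mathcal I^*$ can be extended to a normal ultrafilter on $\kappa$, then $\mathfrak{d}_\kappa(\in^{\mathcal I})=2^\kappa$ and $\mathfrak{b}_\kappa(\in^{\mathcal I})=\kappa^+$. Moreover, $\mathfrak{d}_{\mathrm{Id}^+}(\in^{\mathcal I})=2^\kappa$.
   Context: $\kappa$ is an uncountable cardinal; a normal ultrafilter on $\kappa$ is a nonprincipal $\kappa$-complete normal ultrafilter. The bounded ideal is the ideal of bounded subsets of $\kappa$. Functions $h:\kappa\to\kappa$ used as parameters are assumed to take no finite values (values below $\omega$ are irrelevant). For $h:\kappa\to\kappa$, an $h$-slalom is a function $\varphi$ whose domain is a subset of $\kappa$ with bounded complement, such that $\varphi(\alpha)\subseteq\kappa$ and $|\varphi(\alpha)|=|h(\alpha)|$ for all $\alpha\in\mathrm{dom}(\varphi)$. For $f:\kappa\to\kappa$, write $f\in^{\mathcal I}\varphi$ if $\{\alpha\in\mathrm{dom}(\varphi): f(\alpha)\notin\varphi(\alpha)\}\in\mathcal I$. $\mathfrak{b}_h(\in^{\mathcal I})$ is the least cardinality of a family $\mathcal F\subseteq\kappa^\kappa$ such that for every $h$-slalom $\varphi$ there is $f\in\mathcal F$ with $\neg(f\in^{\mathcal I}\varphi)$. $\mathfrak{d}_h(\in^{\mathcal I})$ is the least cardinality of a family $\mathcal A$ of $h$-slaloms such that for every $f\in\kappa^\kappa$ there is $\varphi\in\mathcal A$ with $f\in^{\mathcal I}\varphi$. The subscript $\kappa$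 means $h=\mathrm{Id}$, the identity on $\kappa$; $\mathrm{Id}^+$ is the function $\alpha\mapsto\alpha^+$. *)

(* Defs.v *)
From mathcomp Require Import all_boot all_order.
From mathcomp Require Import all_classical.
From mathcomp Require wochoice.

Set Implicit Arguments.
Unset Strict Implicit.
Unset Printing Implicit Defensive.

Local Open Scope classical_set_scope.
Local Open Scope card_scope.
Local Open Scope order_scope.

Definition card_lt T U (A : set T) (B : set U) : Prop :=
  A #<= B /\ ~ (B #<= A).
Notation "A '#<' B" := (card_lt A B) (at level 79, format "A  '#<'  B")
  : card_scope.

(* |C| = |A|^+. It suffices to compare C with the sets D over the same type:
   a cardinal with no representative among them is larger than |C|. *)
Definition succ_card T U (A : set T) (C : set U) : Prop :=
  A #< C /\ forall D : set U, A #< D -> C #<= D.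

(* |C| is the least cardinality of a family having property P. *)
Definition least_card T U (P : set (set T)) (C : set U) : Prop :=
  (exists2 F, P F & F #= C) /\ (forall F, P F -> C #<= F).

Section Slaloms.
Context {d : Order.disp_t} {K : orderType d}.
Implicit Types (h f : K -> K) (I : set (set K)).

(* An element a of K plays the role of the ordinal seg a, so |a| is the
   cardinality of seg a. *)
Definition seg (a : K) : set K := [set b | b < a].

Definition ideal I : Prop :=
  [/\ I set0,
      ~ I setT,
      forall A B : set K, A `<=` B -> I B -> I A
    & forall A B : set K, I A -> I B -> I (A `|` B)].

Definition bounded_ideal : set (set K) := [set A | has_ubound A].

Definition dual_filter I : set (set K) := [set A | I (~` A)].

Definition kappa_complete (U : set (set K)) : Prop :=
  forall G : set (set K), G #< [set: K] -> G `<=` U -> U (\bigcap_(A in G) A).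

Definition diagonal_intersection (X : K -> set K) : set K :=
  [set a | forall b, b < a -> X b a].

Definition normal_ultrafilter (U : set (set K)) : Prop :=
  [/\ UltraFilter U,
      forall a, ~ U [set a],
      kappa_complete U
    & forall X : K -> set K, (forall a, U (X a)) ->
        U (diagonal_intersection X)].

(* A slalom is a partial function; None means undefined. *)
Definition dom (phi : K -> option (set K)) : set K := [set a | phi a != None].

Definition slalom h (phi : K -> option (set K)) : Prop :=
  has_ubound (~` dom phi) /\
  forall a S, phi a = Some S -> S #= seg (h a).

Definition in_slalom I f (phi : K -> option (set K)) : Prop :=
  I [set a | exists2 S, phi a = Some S & ~ S (f a)].

Definition unbounded_family I h (F : set (K -> K)) : Prop :=
  forall phi, slalom h phi -> exists2 f, F f & ~ in_slalom I f phi.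

Definition dominating_family I h (A : set (K -> option (set K))) : Prop :=
  A `<=` slalom h /\
  forall f, exists2 phi, A phi & in_slalom I f phi.

Definition b_slalom I h U (C : set U) : Prop :=
  least_card (unbounded_family I h) C.

Definition d_slalom I h U (C : set U) : Prop :=
  least_card (dominating_family I h) C.

(* a |-> a^+, the least b with |a| < |b|. The default value a is only used
   when there is no such b in K, that is when K is the successor cardinal
   of |a|, which cannot happen for a limit cardinal. *)
Definition id_plus (a : K) : K :=
  xget a [set b | seg a #< seg b /\ forall c, seg a #< seg c -> b <= c].

End Slaloms.

(* K, with its order, is (isomorphic to) an uncountable initial ordinal. *)
Definition uncountable_cardinal d (K : orderType d) : Prop :=
  [/\ wochoice.well_order (fun x y : K => x <= y),
      forall a : K, seg a #< [set: K]
    & ~ countable [set: K]].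

(* Main.v *)
Require Import Defs.
From mathcomp Require Import all_boot all_order.
From mathcomp Require Import all_classical.
From mathcomp Require wochoice.

(** Let U be a normal ultrafilter extending the dual filter of I.  A function
    that an I-slalom phi captures satisfies f(a) \in phi(a) for U-almost all a,
    so all lower bounds may be proved for capture modulo U.

    Subsets as functions.  Because kappa carries a nonprincipal kappa-complete
    ultrafilter, it is a strong limit ([card_powerset_seg]), so the subsets of
    a can be coded by elements of kappa.  A subset X of kappa becomes the
    function a |-> c a X coding the intersections of X with all a, and X is
    determined by this function modulo U ([code_agree]), since every set in U
    is unbounded.

    Counting.  If |phi(a)| <= |a|, enumerate phi(a) in type a.  For a captured
    X, the position of c a X in phi(a) is a regressive function of a, hence
    constant on a set in U by normality, and the constant determines X; so phi
    captures at most kappa subsets ([captured_le_seg]).  If only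
    |phi(a)| <= a^+, compare captured sets by the positions of their codes
    modulo U.  This is a well-order, by countable completeness, and each of
    its initial segments is of the previous kind, as every position below a^+
    has at most |a| predecessors.  So phi captures at most kappa^+ subsets
    ([captured_le_id_plus]).

    Conclusion.  By diagonalization a dominating family A of Id^+-slaloms has
    more than kappa members ([dominating_gt]); hence each of them captures at
    most |A| subsets, every subset is captured, and 2^kappa <= |A| * |A| = |A|
    ([dominating_ge]).  Id-slaloms are smaller than Id^+-slaloms, so the same
    bound holds for them.  Conversely a dominating family of size
    kappa^kappa = 2^kappa is obtained by taking for each f one slalom through
    f.  For the bounding number, kappa^+ many functions coding subsets are
    unbounded by the first count, while kappa many functions f_b are captured
    by the slalom with phi(a) containing f_b(a) for all b < a.

    Cardinals are compared through injections only.  The comparison principle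
    used throughout is [well_orders_embed]: a well-order embeds in B as soon
    as B embeds in none of its initial segments.  Comparability of
    cardinals, A * A = A for infinite A, successor cardinals and the bound
    kappa^+ above are all read off from it. *)

Set Implicit Arguments.
Unset Strict Implicit.
Unset Printing Implicit Defensive.

Import Order.TTheory.
Local Open Scope order_scope.
Local Open Scope classical_set_scope.
Local Open Scope card_scope.

(** * Injections *)

(** The injection is given by a relation, so that neither type has to be
    inhabited and the choice of values stays inside the proof. *)
Lemma card_le_rel T U (A : set T) (B : set U) (R : T -> U -> Prop) :
    (forall x, A x -> exists2 y, B y & R x y) ->
    (forall x x' y, A x -> A x' -> R x y -> R x' y -> x = x') ->
  A #<= B.
Proof.
move=> AB Rinj.
have /choice[f fP] : forall x : A, exists y, B y /\ R (val x) y.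
  by move=> x; have [y By Rxy] := AB _ (set_valP x); exists y.
rewrite -(card_le_eql (card_setT A)).
have finj : {in [set: A] &, injective f}.
  move=> x y _ _ fxy; apply: val_inj; apply: (Rinj _ _ (f x)).
  - exact: set_valP.
  - exact: set_valP.
  - by case: (fP x).
  - by rewrite fxy; case: (fP y).
rewrite -(card_le_eql (inj_card_eq finj)).
by apply: subset_card_le => _ [x _ <-]; case: (fP x).
Qed.

Lemma card_le_fun T U (A : set T) (B : set U) : A #<= B -> forall y0 : U,
  exists2 f : T -> U, (forall x, A x -> B (f x)) &
    forall x x', A x -> A x' -> f x = f x' -> x = x'.
Proof.
elim/Ppointed: U => U in B *; first by move=> AB y0; case: (no y0).
move=> /pcard_leP[f] y0.
exists f; first by move=> x Ax; exact: funS.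
by move=> x x' Ax Ax' ff; apply: (@inj _ _ A f) => //; rewrite inE.
Qed.

(** * Well-orders and comparison of cardinals *)

(** [R] is a strict well-order of [D].  The existence of minimal elements
    implies irreflexivity, and then totality gives transitivity. *)
Definition well_orders T (D : set T) (R : T -> T -> Prop) :=
  (forall x y, D x -> D y -> [\/ R x y, x = y | R y x]) /\
  (forall A, A `<=` D -> A !=set0 -> exists2 m, A m & forall y, A y -> ~ R y m).

Lemma well_orders_subset T (D D' : set T) R :
  D' `<=` D -> well_orders D R -> well_orders D' R.
Proof.
move=> D'D [tot mn]; split=> [x y /D'D Dx /D'D|]; first exact: tot.
by move=> A AD'; apply: mn; apply: subset_trans D'D.
Qed.

Lemma well_orders_trans T (D : set T) R x y z :
  well_orders D R -> D x -> D y -> D z -> R x y -> R y z -> R x z.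
Proof.
move=> DR Dx Dy Dz Rxy Ryz; have [tot mn] := DR.
have [// | xz | Rzx] := tot x z Dx Dz; last first.
  have [||m mxyz mmin] := mn [set u | [\/ u = x, u = y | u = z]].
  - by move=> u [] ->.
  - by exists x; constructor 1.
  exfalso; case: mxyz mmin => -> mmin.
  - by apply: (mmin z) => //; constructor 3.
  - by apply: (mmin x) => //; constructor 1.
  - by apply: (mmin y) => //; constructor 2.
have [||m mxy mmin] := mn [set u | u = x \/ u = y].
- by move=> u [] ->.
- by exists x; left.
exfalso; case: mxy mmin => -> mmin.
- by apply: (mmin y); [right|rewrite xz].
- by apply: (mmin x) => //; left.
Qed.

Lemma well_order_strict (T : eqType) (R : rel T) :
  wochoice.well_order R -> well_orders setT (fun x y => ~~ R y x).
Proof.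
move=> wo; have Rmin A : A !=set0 -> exists2 m, A m & forall y, A y -> R m y.
  move=> [a Aa]; have [|m [[mA mmin] _]] := wo (mem A).
    by exists a; rewrite inE.
  exists m => [|y Ay]; first by move: mA; rewrite inE.
  by apply: mmin; rewrite inE.
split=> [x y _ _|A _ /Rmin[m Am mmin]]; last first.
  by exists m => // y /mmin ->.
have [Ryx|] := boolP (R y x); last by constructor 1.
have [Rxy|] := boolP (R x y); last by constructor 3.
constructor 2.
have Rrefl u : R u u by have [|v -> /(_ u erefl)] := Rmin [set u]; first exists u.
have [|m [_ mu]] := wo (mem (pred2 x y)); first by exists x; rewrite !inE eqxx.
transitivity m; last apply: mu; first apply/esym/mu.
- split=> [|z]; first by rewrite !inE eqxx.
  by rewrite !inE => /orP[]/eqP->.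
- split=> [|z]; first by rewrite !inE eqxx orbT.
  by rewrite !inE => /orP[]/eqP->.
Qed.

Lemma exists_well_order T : exists R, well_orders [set: T] R.
Proof.
elim/Peq: T => T; have [R /well_order_strict wo] := wochoice.well_ordering_principle T.
by eexists; exact: wo.
Qed.

(** Map each [x] to an element of [B] that is not the value of any predecessor
    of [x]; there is one, since otherwise [B] would inject into the initial
    segment of [x]. *)
Lemma well_orders_embed T U (D : set T) R (B : set U) :
    well_orders D R -> (forall x, D x -> ~ (B #<= D `&` R^~ x)) ->
  D #<= B.
Proof.
move=> DR noB.
have [[x0 Dx0]|D0] := pselect (D !=set0); last first.
  by rewrite (_ : D = set0) ?card_ge0//; apply/seteqP; split=> // x Dx; case: D0; exists x.
have [u0] : inhabited U.
  apply: contrapT => noU; apply: (noB x0 Dx0).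
  rewrite (_ : B = set0) ?card_ge0//.
  by apply/seteqP; split=> // u; case: noU; exists.
(* The recursion runs over all of T, with no predecessors outside D. *)
pose S y x := [/\ D y, D x & R y x].
have Swf : well_founded S.
  move=> x; apply: contrapT => nAcc.
  have [tot mn] := DR.
  have [||m [Dm nAm] mmin] := mn [set y | D y /\ ~ Acc S y]; first by move=> y [].
    exists x; split=> //; apply: contrapT => nDx; apply: nAcc.
    by constructor=> y [_ Dx].
  apply: nAm; constructor => y [Dy _ Rym]; apply: contrapT => nAy.
  exact: (mmin y).
pose F x (f : forall y, S y x -> U) : U :=
  xget (u0 : {classic U}) [set u | B u /\ forall y (h : S y x), f y h <> u].
pose f := Fix Swf (fun=> U) F.
have fE x : f x = xget (u0 : {classic U}) [set u | B u /\ forall y, S y x -> f y <> u].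
  rewrite /f Fix_eq // => {}x g h gh.
  by congr F; apply: functional_extensionality_dep => y;
     apply: functional_extensionality_dep => s.
have fP x : D x -> B (f x) /\ forall y, S y x -> f y <> f x.
  move=> Dx.
  suff: exists u, B u /\ forall y, S y x -> f y <> u.
    by move=> /(xgetPex (u0 : {classic U})); rewrite -fE.
  apply: contrapT => no; apply: (noB x Dx).
  apply: (card_le_rel (R := fun u y => f y = u)) => [u Bu|u u' y _ _ -> //].
  apply: contrapT => noy; apply: no; exists u; split=> // y [Dy _ Ryx] fyu.
  by apply: noy; exists y.
apply: (card_le_rel (R := fun x u => f x = u)).
  by move=> x /fP[Bfx _]; exists (f x).
move=> x x' _ Dx Dx' <- ffx.
have [Rxx'|//|Rx'x] := DR.1 x x' Dx Dx'.
- by have [_ /(_ x)] := fP _ Dx'; case.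
- by have [_ /(_ x')] := fP _ Dx; case.
Qed.

(** Well-order [A]: either [B] injects into some initial segment, or
    [well_orders_embed] applies. *)
Lemma card_le_total T U (A : set T) (B : set U) : A #<= B \/ B #<= A.
Proof.
have [R woR] := exists_well_order T.
have {}woR : well_orders A R by apply: well_orders_subset woR.
have [|no] := pselect (exists2 x, A x & B #<= A `&` R^~ x).
  by move=> [x Ax Bx]; right; apply: card_le_trans Bx _; apply: subset_card_le => ? [].
by left; apply: (well_orders_embed woR) => x Ax Bx; apply: no; exists x.
Qed.

Lemma card_nle T U (A : set T) (B : set U) : ~ (A #<= B) -> B #< A.
Proof. by move=> nAB; split=> //; have [/nAB|] := card_le_total A B. Qed.

(** * The square of an infinite cardinal *)

Lemma card_set1_le T U (x : T) (B : set U) : B !=set0 -> [set x] #<= B.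
Proof.
move=> [b Bb].
by apply: (card_le_rel (R := fun=> eq b)) => [u _|u u' _ -> ->//]; exists b.
Qed.

Lemma card_le_setX T T' U U' (A : set T) (A' : set T') (B : set U) (B' : set U') :
  A #<= A' -> B #<= B' -> A `*` B #<= A' `*` B'.
Proof.
move=> AA' BB'.
have [[[x0 y0] [Ax0 By0]]|no] := pselect (A `*` B !=set0); last first.
  by rewrite (_ : _ `*` _ = set0) ?card_ge0//; apply/seteqP; split=> // p Dp; case: no; exists p.
have [x1 _] : A' !=set0.
  by apply/set0P; apply: contraTneq AA' => ->; rewrite card_le0; apply/set0P; exists x0.
have [y1 _] : B' !=set0.
  by apply/set0P; apply: contraTneq BB' => ->; rewrite card_le0; apply/set0P; exists y0.
have [f fA finj] := card_le_fun AA' x1; have [g gB ginj] := card_le_fun BB' y1.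
apply: (card_le_rel (R := fun p q => q = (f p.1, g p.2))).
  by move=> [x y] [/= /fA ? /gB ?]; exists (f x, g y).
by move=> [x y] [x' y'] q [/= Ax By] [/= Ax' By'] -> [/finj-> // /ginj->].
Qed.

(** The assumption on [E * E] is kept explicit because this lemma serves in the
    proof that it always holds. *)
Lemma card_leU T V (A B : set T) (E : set V) :
    infinite_set E -> E `*` E #<= E -> A #<= E -> B #<= E ->
  A `|` B #<= E.
Proof.
move=> infE EE AE BE; apply: card_le_trans EE.
have [e0 Ee0] := infinite_setN0 infE.
have [e1 Ee1 e10] : exists2 e1, E e1 & e1 <> e0.
  apply: contrapT => no; apply: infE; apply: (sub_finite_set _ (finite_set1 e0)).
  by move=> e Ee; apply: contrapT => ne; apply: no; exists e.
have [f fA finj] := card_le_fun AE e0; have [g gB ginj] := card_le_fun BE e0.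
apply: (card_le_rel (R := fun x p => (A x /\ p = (f x, e0)) \/ (B x /\ p = (g x, e1)))).
  move=> x [] Xx; first by exists (f x, e0); [split=> //; exact: fA|left].
  by exists (g x, e1); [split=> //; exact: gB|right].
move=> x x' p _ _ [] [Xx ->] [] [Xx' []].
- exact: finj.
- by move=> _ /esym.
- by move=> _.
- exact: ginj.
Qed.

Section Goedel.
Context {T : Type} (R : T -> T -> Prop) (D : set T) (DR : well_orders D R).

Let mx (p : T * T) : T := if `[< R p.1 p.2 >] then p.2 else p.1.

(** Goedel's order of pairs: by maximum first, then lexicographically.  The
    maximum comes first so that the pairs preceding p lie in the square of an
    initial segment. *)
Definition goedel (p q : T * T) : Prop :=
  R (mx p) (mx q) \/
  mx p = mx q /\ (R p.1 q.1 \/ p.1 = q.1 /\ R p.2 q.2).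

Let mxD p : (D `*` D) p -> D (mx p).
Proof. by move=> [Dp1 Dp2]; rewrite /mx; case: ifP. Qed.

Lemma goedel_well_orders : well_orders (D `*` D) goedel.
Proof.
have [tot mn] := DR; split.
  move=> [x y] [x' y'] Dp Dq.
  have [mpq|mpq|mqp] := tot _ _ (mxD Dp) (mxD Dq).
  - by constructor 1; left.
  - have [Rxx'|xx'|Rx'x] := tot _ _ Dp.1 Dq.1.
    + by constructor 1; right; split=> //; left.
    + have [Ryy'|yy'|Ry'y] := tot _ _ Dp.2 Dq.2.
      * by constructor 1; right; split=> //; right.
      * by constructor 2; rewrite (_ : x = x')// (_ : y = y').
      * by constructor 3; right; split=> //; right.
    + by constructor 3; right; split=> //; left.
  - by constructor 3; left.
move=> A AD [p0 Ap0].
have [||m [p1 Ap1 <-] mmin] := mn (mx @` A).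
- by move=> _ [p /AD/mxD Dp <-].
- by exists (mx p0), p0.
pose A1 := [set p | A p /\ mx p = mx p1].
have [||x [p2 [Ap2 m2] <-] xmin] := mn (fst @` A1).
- by move=> _ [p [/AD[]? _ _] <-].
- by exists p1.1, p1.
pose A2 := [set p | A1 p /\ p.1 = p2.1].
have [||y [p3 [[Ap3 m3] p31] <-] ymin] := mn (snd @` A2).
- by move=> _ [p [[/AD[]]] ? ? _ _ <-].
- by exists p2.2, p2.
exists p3 => // q Aq [|[mq [|[q1]]]].
- by rewrite m3; apply: mmin; exists q.
- by rewrite p31; apply: xmin; exists q => //; split=> //; rewrite mq.
- by apply: ymin; exists q => //; split; [split=> //; rewrite mq|rewrite q1].
Qed.

Lemma goedel_initial p m : (D `*` D) p -> D m -> R (mx p) m ->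
  (D `*` D) `&` goedel^~ p `<=` (D `&` R^~ m) `*` (D `&` R^~ m).
Proof.
move=> Dp Dm pm q [Dq qp]; have [tot _] := DR.
have trans := well_orders_trans DR.
have qm : R (mx q) m.
  by case: qp => [qp|[-> //]]; apply: trans pm => //; exact: mxD.
have [Dq1 Dq2] := Dq.
suff [] : R q.1 m /\ R q.2 m by [].
move: qm; rewrite /mx; case: asboolP => [q12 q2m|nq12 q1m].
  by split=> //; apply: trans q2m.
split=> //; have [//|<- //|q21] := tot _ _ Dq1 Dq2.
by apply: trans q1m.
Qed.

End Goedel.

(** Pass to a counterexample [D] that is an initial segment of a well-order and
    as short as possible.  Its proper initial segments are finite or have the
    size of their squares, so they are smaller than [D]; hence so are those of
    Goedel's order on [D * D], which therefore embeds in [D]. *)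
Lemma card_setXid T (A : set T) : infinite_set A -> A `*` A #<= A.
Proof.
have [R woR] := exists_well_order T.
move=> infA; apply: contrapT => nA.
have [D [infD nD Dseg]] : exists D : set T, [/\ infinite_set D, ~ (D `*` D #<= D) &
    forall y, D y -> infinite_set (D `&` R^~ y) ->
      (D `&` R^~ y) `*` (D `&` R^~ y) #<= D `&` R^~ y].
  pose bad y := [/\ A y, infinite_set (A `&` R^~ y) &
    ~ ((A `&` R^~ y) `*` (A `&` R^~ y) #<= A `&` R^~ y)].
  have [[y0 bady0]|nobad] := pselect (exists y, bad y); last first.
    exists A; split=> // y Ay infy; apply: contrapT => ny; apply: nobad.
    by exists y.
  have [//||y [Ay infy ny] ymin] := woR.2 bad; first by exists y0.
  exists (A `&` R^~ y); split=> // z [Az Rzy].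
  have -> : A `&` R^~ y `&` R^~ z = A `&` R^~ z.
    apply/seteqP; split=> u [] => [[]//|Au Ruz]; split=> //; split=> //.
    exact: (well_orders_trans woR) Rzy.
  by move=> infz; apply: contrapT => nz; apply: (ymin z).
have {}woR : well_orders D R by apply: well_orders_subset woR.
have limD y : D y -> ~ (D #<= D `&` R^~ y).
  move=> Dy DDy; apply: nD.
  have infy : infinite_set (D `&` R^~ y).
    by move=> /(card_le_finite DDy).
  apply: card_le_trans (card_le_setX DDy DDy) _.
  by apply: card_le_trans (Dseg y Dy infy) _; apply: subset_card_le => ? [].
(* D has no last element: removing it would not change the cardinality. *)
have nomax m : D m -> exists2 m', D m' & R m m'.
  move=> Dm; apply: contrapT => no; apply: (limD m Dm).
  have DU : D `<=` (D `&` R^~ m) `|` [set m].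
    move=> y Dy; have [Rym|->|Rmy] := woR.1 _ _ Dy Dm.
    - by left.
    - by right.
    - by case: no; exists y.
  have infm : infinite_set (D `&` R^~ m).
    move=> finm; apply: infD; apply: sub_finite_set DU _.
    by rewrite finite_setU; split=> //; exact: finite_set1.
  apply: card_le_trans (subset_card_le DU) _.
  apply: card_leU => //; first exact: Dseg.
  exact/card_set1_le/infinite_setN0.
apply: nD; apply: (well_orders_embed (goedel_well_orders woR)) => p Dp.
have Dmx : D (if `[< R p.1 p.2 >] then p.2 else p.1).
  by case: Dp => ? ?; case: ifP.
have [m' Dm' mm'] := nomax _ Dmx.
move=> /card_le_trans /(_ (subset_card_le (goedel_initial woR Dp Dm' mm'))).
have [finm|infm] := pselect (finite_set (D `&` R^~ m')).
  by move=> /card_le_finite finD; apply: infD; apply: finD; exact: finite_setX.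
by move=> /card_le_trans /(_ (Dseg _ Dm' infm)); apply: limD.
Qed.

Lemma card_lt_le T U V (A : set T) (B : set U) (C : set V) :
  A #<= B -> B #< C -> A #< C.
Proof.
move=> AB [BC nCB]; split; first exact: card_le_trans BC.
by move=> CA; apply: nCB; apply: card_le_trans AB.
Qed.

(** The subset [C] has the cardinality of the successor of [A]: it is the
    shortest initial segment of a well-order of [T] not embedding in [A]. *)
Lemma exists_card_succ T U (A : set U) : ~ ([set: T] #<= A) ->
  exists2 C : set T, ~ (C #<= A) &
    forall V (D : set V), ~ (D #<= A) -> C #<= D.
Proof.
move=> nA; have [R woR] := exists_well_order T.
have [C nC Cseg] : exists2 C : set T, ~ (C #<= A) &
    forall x, C x -> C `&` R^~ x #<= A.
  have [[x0 nx0]|small] := pselect (exists x, ~ (R^~ x #<= A)); last first.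
    exists setT => // x _; apply: contrapT => nx; apply: small; exists x.
    by rewrite setTI in nx.
  have [//||x nx xmin] := woR.2 [set x | ~ (R^~ x #<= A)]; first by exists x0.
  exists (R^~ x) => // y Ryx; apply: card_le_trans (_ : R^~ y #<= _).
    by apply: subset_card_le => ? [].
  by apply: contrapT => ny; apply: (xmin y).
exists C => // V D nD; apply: (well_orders_embed (R := R)).
  exact: well_orders_subset woR.
by move=> x /Cseg Cx Dx; apply: nD; apply: card_le_trans Cx.
Qed.

Lemma cantor T : ~ ([set: set T] #<= [set: T]).
Proof.
move=> /[dup] le.
have [t0] : inhabited T.
  apply: contrapT => noT; move: le.
  rewrite (_ : [set: T] = set0) ?card_le0; last first.
    by apply/seteqP; split=> // t; case: noT.
  by move=> /eqP/seteqP[/(_ set0)] /(_ I).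
move=> /card_le_fun/(_ t0) [f _ finj].
pose D := [set t | exists2 X, f X = t & ~ X t].
have nD : ~ D (f D).
  move=> /[dup] Df [X /finj XD nX]; apply: nX; rewrite XD//.
by apply: (nD); exists D.
Qed.

(** * Cardinals below kappa *)

Section Measurable.
Context {d : Order.disp_t} {K : orderType d}.
Context (woK : well_orders [set: K] (fun x y => x < y)).
Context (segK : forall a : K, seg a #< [set: K]).
Context (uncountableK : ~ countable [set: K]).

Lemma infinite_card : infinite_set [set: K].
Proof. by move=> /finite_set_countable. Qed.

Lemma card_inhabited : exists x : K, True.
Proof. by have [x _] := infinite_setN0 infinite_card; exists x. Qed.

Lemma countable_card_lt T (A : set T) : countable A -> A #< [set: K].
Proof.
move=> cA; apply: card_nle => KA; apply: uncountableK.
exact: sub_countable KA cA.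
Qed.

(** By minimality of a^+ and comparability of cardinals; the default value [a]
    of [id_plus a] is no exception. *)
Lemma id_plus_seg (a b : K) : b < id_plus a -> seg b #<= seg a.
Proof.
rewrite /id_plus; case: xgetP => [c _ [_ cmin] bc|_ ba].
  apply: contrapT => /card_nle/cmin.
  by rewrite leNgt bc.
by apply: subset_card_le => x /= xb; exact: lt_trans ba.
Qed.

Lemma id_plus_ge (a : K) : a <= id_plus a.
Proof.
rewrite /id_plus; case: xgetP => [c _ [[_ ncs] _]|//].
rewrite leNgt; apply/negP => ca; apply: ncs; apply: subset_card_le => x /= xc.
exact: lt_trans ca.
Qed.

Lemma seg_id_plus (a : K) : seg a #<= seg (id_plus a).
Proof.
by apply: subset_card_le => x xa; exact: lt_le_trans xa (id_plus_ge a).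
Qed.

(** Otherwise all initial segments are finite and kappa embeds in the natural
    numbers. *)
Lemma exists_infinite_seg : exists a : K, infinite_set (seg a).
Proof.
apply: contrapT => no; apply: uncountableK.
apply: (well_orders_embed woK) => x _ leN; apply: no; exists x.
apply/infiniteP; apply: card_le_trans leN _; rewrite setTI.
exact: subset_card_le.
Qed.

(** * Normal ultrafilters *)

Section Ultrafilter.
Context (U : set (set K)) (nU : normal_ultrafilter U).

Let ultraU : UltraFilter U. Proof. by case: nU. Qed.
#[local] Existing Instance ultraU.

Lemma small_bigcap T (D : set T) (F : T -> set K) :
  D #< [set: K] -> (forall x, D x -> U (F x)) -> U (\bigcap_(x in D) F x).
Proof.
move=> smallD UF; have [_ _ completeU _] := nU.
have := completeU (F @` D); rewrite bigcap_image; apply.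
  exact: card_lt_le (card_image_le _ _) smallD.
by move=> _ [x /UF ? <-].
Qed.

Lemma small_null (A : set K) : A #< [set: K] -> U (~` A).
Proof.
move=> smallA; have [_ nonprincipal _ _] := nU.
apply: filterS (small_bigcap smallA (F := fun x => ~` [set x]) _).
  by move=> x nx Ax; exact: (nx x Ax).
by move=> x _; have [/nonprincipal|] := in_ultra_setVsetC [set x] ultraU.
Qed.

Lemma above_large (a : K) : U [set b | a < b].
Proof.
have aseg : seg a `|` [set a] #< [set: K].
  have [infa|fina] := pselect (infinite_set (seg a)).
    apply: card_lt_le (segK a); apply: card_leU => //; first exact: card_setXid.
    exact/card_set1_le/infinite_setN0.
  apply: countable_card_lt; apply: finite_set_countable.
  rewrite finite_setU; split; last exact: finite_set1.
  exact: contrapT.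
apply: filterS (small_null aseg) => b /= /not_orP[nba nb].
by rewrite ltNge le_eqVlt; apply/negP => /orP[/eqP|].
Qed.

(** Otherwise [g a <> b] holds U-almost everywhere for each [b], and an element
    [a] of the diagonal intersection of these sets with [g a < a] has
    [g a <> g a]. *)
Lemma regressive_constant (g : K -> K) :
  U [set a | g a < a] -> exists b, U [set a | g a = b].
Proof.
move=> gU; apply: contrapT => no; have [_ _ _ normalU] := nU.
have/normalU Udiag b : U [set a | g a <> b].
  have [Ub|//] := in_ultra_setVsetC [set a | g a = b] ultraU.
  by case: no; exists b.
have [a [ga /(_ _ ga)]] := filter_ex (filterI gU Udiag).
exact.
Qed.

(** If kappa many distinct subsets [j y] of [a] existed, deciding membership of
    each [b < a] by a set in U and intersecting these fewer than kappa
    sets would give a set in U on which [j] is constant, hence a singleton. *)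
Lemma card_powerset_seg (a : K) : [set X : set K | X `<=` seg a] #<= [set: K].
Proof.
have [//|KP] := card_le_total [set X : set K | X `<=` seg a] [set: K].
have [j jsub jinj] := card_le_fun KP set0.
(* The y for which j y agrees at b with its value for U-almost all indices. *)
pose F b := [set x | U (fun y => j y b) <-> j x b].
have UF : U (\bigcap_(b in seg a) F b).
  apply: small_bigcap => // b _.
  have [Ub|Ub] := in_ultra_setVsetC (fun y => j y b) ultraU.
    by apply: filterS (Ub) => x jx; split.
  apply: filterS (Ub) => x njx; split=> // jUb.
  by have [y []] := filter_ex (filterI Ub jUb).
have [x Fx] := filter_ex UF.
have [_ /(_ x) nonprincipal _ _] := nU; exfalso; apply: nonprincipal.
apply: filterS UF => y Fy; apply: jinj => //; apply/seteqP; split=> b jb.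
  have ab := jsub _ I _ jb.
  by apply/(Fx b ab); apply/(Fy b ab).
have ab := jsub _ I _ jb.
by apply/(Fy b ab); apply/(Fx b ab).
Qed.

Lemma exists_code : exists c : K -> set K -> K,
  forall a X Y, c a X = c a Y -> X `&` seg a = Y `&` seg a.
Proof.
have /choice[c cP] : forall a, exists c : set K -> K,
    forall X Y, c X = c Y -> X `&` seg a = Y `&` seg a.
  move=> a; have [x0 _] := card_inhabited.
  have [c _ cinj] := card_le_fun (card_powerset_seg a) x0.
  by exists (fun X => c (X `&` seg a)) => X Y; apply: cinj => x [].
by exists c.
Qed.

(** * Counting the subsets captured modulo U *)

Section Code.
Context (c : K -> set K -> K).
Context (cP : forall a X Y, c a X = c a Y -> X `&` seg a = Y `&` seg a).

Lemma code_agree X Y : U [set a | c a X = c a Y] -> X = Y.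
Proof.
move=> UXY; apply/seteqP; split=> x Xx;
  have [a [/= xa /cP XYa]] := filter_ex (filterI (above_large x) UXY).
- by have [] : (Y `&` seg a) x by rewrite -XYa.
- by have [] : (X `&` seg a) x by rewrite XYa.
Qed.

(** The relation [E] stands for a slalom; values of [E] may be empty, which
    takes care of undefined slalom values. *)
Definition captured (E : K -> set K) : set (set K) :=
  [set X | U [set a | E a (c a X)]].

(** The position of [c a X] in [E a] is regressive in [a], hence U-almost
    everywhere equal to some [b], and [b] determines [X]. *)
Lemma captured_le_seg E :
  (forall a, E a #<= seg a) -> captured E #<= [set: K].
Proof.
move=> Eseg; have [x0 _] := card_inhabited.
have /choice[e eP] : forall a, exists e : K -> K, (forall x, E a x -> e x < a) /\
    forall x x', E a x -> E a x' -> e x = e x' -> x = x'.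
  by move=> a; have [e e1 e2] := card_le_fun (Eseg a) x0; exists e.
apply: (card_le_rel
  (R := fun X b => U [set a | E a (c a X) /\ e a (c a X) = b])).
  move=> X EX; have [|b Ub] := @regressive_constant (fun a => e a (c a X)).
    by apply: (filterS _ (EX : U _)) => a; exact: (eP a).1.
  by exists b => //; apply: filterS (filterI (EX : U _) Ub).
move=> X Y b _ _ UX UY; apply: code_agree; apply: filterS (filterI UX UY).
by move=> a [[EX eX] [EY eY]]; apply: (eP a).2 => //; rewrite eX eY.
Qed.

(** The bound kappa^+ without mentioning kappa^+: it embeds in every set that is
    not of size at most kappa.  The positions [g X a] of the codes in [E a],
    compared modulo U, well-order the captured sets with initial segments of
    size at most kappa. *)
Lemma captured_le_id_plus E T (B : set T) :
    (forall a, E a #<= seg (id_plus a)) -> ~ (B #<= [set: K]) ->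
  captured E #<= B.
Proof.
move=> Eseg nB; have [x0 _] := card_inhabited.
have /choice[e eP] : forall a, exists e : K -> K,
    (forall x, E a x -> e x < id_plus a) /\
    forall x x', E a x -> E a x' -> e x = e x' -> x = x'.
  by move=> a; have [e e1 e2] := card_le_fun (Eseg a) x0; exists e.
pose g X a := e a (c a X).
pose R X Y := U [set a | g X a < g Y a].
have woR : well_orders (captured E) R.
  split=> [X Y EX EY|A AE [X0 AX0]].
    have [|UXY] := in_ultra_setVsetC [set a | g X a < g Y a] ultraU.
      by constructor 1.
    have [|UYX] := in_ultra_setVsetC [set a | g Y a < g X a] ultraU.
      by constructor 3.
    constructor 2; apply: code_agree.
    apply: filterS (filterI (filterI (EX : U _) (EY : U _)) (filterI UXY UYX)).
    move=> a [[/= EaX EaY] [/negP gXY /negP gYX]]; apply: (eP a).2 => //.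
    by apply/eqP; rewrite eq_le leNgt gYX leNgt gXY.
  (* A strictly descending sequence would descend at a single a. *)
  apply: contrapT => no.
  have /choice[s sP] : forall X, exists Y, A X -> A Y /\ R Y X.
    move=> X; have [AX|] := pselect (A X); last by exists X.
    apply: contrapT => noY; apply: no; exists X => // Y AY RYX.
    by apply: noY; exists Y.
  pose Z n := iter n s X0.
  have AZ n : A (Z n) by elim: n => [//|n /sP[]].
  have : U (\bigcap_(n in [set: nat]) [set a | g (Z n.+1) a < g (Z n) a]).
    apply: small_bigcap => [|n _]; first exact: countable_card_lt.
    by have [] := sP _ (AZ n).
  move=> /filter_ex[a desc].
  have [//||_ [n _ <-] nmin] := woK.2 (range (fun n => g (Z n) a)).
    by exists (g (Z 0) a), 0.
  by apply: (nmin (g (Z n.+1) a)); [exists n.+1|exact: (desc n I)].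
apply: (well_orders_embed woR) => Y EY; apply: contra_not nB.
move=> /card_le_trans; apply.
(* The sets preceding Y are captured by the part of E before the code of Y. *)
pose E' a := [set x | [/\ E a x, E a (c a Y) & e a x < g Y a]].
have E'seg a : E' a #<= seg a.
  have [EYa|nEYa] := pselect (E a (c a Y)); last first.
    by rewrite (_ : E' a = set0) ?card_ge0//; apply/seteqP; split=> // x [].
  apply: card_le_trans (id_plus_seg ((eP a).1 _ EYa)).
  apply: (card_le_rel (R := fun x y => y = e a x)) => [x [_ _ ?]|].
    by exists (e a x).
  by move=> x x' y [Ex _ _] [Ex' _ _] -> xx'; exact: (eP a).2.
apply: card_le_trans (captured_le_seg E'seg); apply: subset_card_le.
by move=> X [EX RXY]; apply: filterS (filterI (filterI (EX : U _) (EY : U _)) (RXY : U _)) => a [[]].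
Qed.

End Code.

Definition slalom_rel (phi : K -> option (set K)) (a : K) : set K :=
  [set x | exists2 S, phi a = Some S & S x].

Lemma slalom_rel_le phi (a b : K) :
    (forall S, phi a = Some S -> S #<= seg b) ->
  slalom_rel phi a #<= seg b.
Proof.
rewrite /slalom_rel; case: (phi a) => [S /(_ S erefl) Sb|_]; last first.
  by rewrite (_ : [set x | _] = set0) ?card_ge0//; apply/seteqP; split=> // x [].
by apply: card_le_trans Sb; apply: subset_card_le => x [_ [<-]].
Qed.

(** * Dominating families modulo U *)

Section Dominating.
Context (A : set (K -> option (set K))).
Context (A_le :
  forall phi, A phi -> forall a, slalom_rel phi a #<= seg (id_plus a)).
Context (A_dom :
  forall f : K -> K, exists2 phi, A phi & U [set a | slalom_rel phi a (f a)]).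

(** If [A] could be indexed by kappa, let [f a] avoid all slaloms of index below
    [a] at [a]; they cover only a U-null set, as a union of fewer than kappa sets of
    size less than kappa. *)
Lemma dominating_gt : ~ (A #<= [set: K]).
Proof.
move=> AK; have [x0 _] := card_inhabited.
have [i _ iinj] := card_le_fun AK x0.
have /choice[f fP] : forall a, exists x, forall phi,
    A phi -> i phi < a -> ~ slalom_rel phi a x.
  move=> a.
  have : U (\bigcap_(phi in [set phi | A phi /\ i phi < a]) ~` slalom_rel phi a).
    apply: small_bigcap.
      apply: card_lt_le (segK a).
      apply: (card_le_rel (R := fun phi b => b = i phi)) => [phi [_ ia]|].
        by exists (i phi).
      by move=> phi psi b [Aphi _] [Apsi _] -> /iinj; exact.
    move=> phi [Aphi _]; apply: small_null.
    exact: card_lt_le (A_le Aphi a) (segK _).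
  by move=> /filter_ex[x xP]; exists x => phi Aphi ia; exact: xP.
have [phi Aphi Uphi] := A_dom f.
have [a [/= ia]] := filter_ex (filterI (above_large (i phi)) Uphi).
exact: fP.
Qed.

(** Send a subset [X] to a slalom [phi] in [A] capturing it, together with the
    place of [X] among the sets captured by [phi], which number at most [A]. *)
Lemma dominating_ge : [set: set K] #<= A.
Proof.
have [c cP] := exists_code.
have infA : infinite_set A.
  move=> finA; apply: dominating_gt.
  by have [] := countable_card_lt (finite_set_countable finA).
have [phi0 _] := infinite_setN0 infA.
apply: card_le_trans (card_setXid infA).
have /choice[k kP] : forall phi, exists k : set K -> K -> option (set K),
    A phi -> (forall X, captured c (slalom_rel phi) X -> A (k X)) /\
    forall X Y, captured c (slalom_rel phi) X -> captured c (slalom_rel phi) Y ->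
      k X = k Y -> X = Y.
  move=> phi; have [Aphi|nA] := pselect (A phi); last by exists (fun=> phi0).
  have cap_le := captured_le_id_plus cP (A_le Aphi) dominating_gt.
  by have [k k1 k2] := card_le_fun cap_le phi0; exists k.
apply: (card_le_rel (R := fun X p =>
  [/\ A p.1, captured c (slalom_rel p.1) X & p.2 = k p.1 X])).
  move=> X _; have [phi Aphi Uphi] := A_dom (fun a => c a X).
  by exists (phi, k phi X) => //; split=> //; exact: (kP _ Aphi).1.
move=> X Y [phi psi] _ _ [/= Aphi capX ->] [_ capY].
exact: (kP _ Aphi).2.
Qed.

End Dominating.

End Ultrafilter.
End Measurable.

(** Through its graph a function is a subset of T * T, which has the size
    of T. *)
Lemma card_fun_le_powerset T : infinite_set [set: T] ->
  [set: T -> T] #<= [set: set T].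
Proof.
move=> infT; have [t0 _] := infinite_setN0 infT.
have [p _ pinj] := card_le_fun (card_setXid infT) t0.
apply: (card_le_rel (R := fun f X => X = [set p (x, f x) | x in setT])).
  by move=> f _; exists [set p (x, f x) | x in setT].
move=> f g X _ _ -> fg; apply/funext => x.
have [y _ pyx] : [set p (y, g y) | y in setT] (p (x, f x)).
  by rewrite -fg; exists x.
have [-> //] : (y, g y) = (x, f x) by exact: pinj.
Qed.

(** If [x] is not in [S], exchange it for an element of [S]. *)
Lemma card_eq_containing T (S : set T) (x : T) : S !=set0 ->
  exists2 S', S' x & S' #= S.
Proof.
move=> [s Ss]; have [Sx|nSx] := pselect (S x); first by exists S.
pose t y := if `[< y = s >] then x else y.
have tinj : {in S &, injective t}.
  move=> y z; rewrite !inE /t => Sy Sz.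
  by case: asboolP => [->|_]; case: asboolP => [->|_] // xz; case: nSx;
    rewrite ?xz // -xz.
exists (t @` S); last exact: inj_card_eq.
by exists s => //; rewrite /t asboolT.
Qed.

(** * The cardinals of slaloms *)

Section Slaloms.
Context {d : Order.disp_t} {K : orderType d}.
Context (woK : well_orders [set: K] (fun x y => x < y)).
Context (segK : forall a : K, seg a #< [set: K]).
Context (uncountableK : ~ countable [set: K]).
Context (I : set (set K)) (HbI : bounded_ideal `<=` I).
Context (U : set (set K)) (nU : normal_ultrafilter U) (IU : dual_filter I `<=` U).

Let ultraU : UltraFilter U. Proof. by case: nU. Qed.
#[local] Existing Instance ultraU.

Lemma slalom_capture h phi f : slalom h phi -> in_slalom I f phi ->
  U [set a | slalom_rel phi a (f a)].
Proof.
move=> [domphi _] If.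
have Udom : U (dom phi) by apply/IU/HbI.
have Unbad : U (~` [set a | exists2 S, phi a = Some S & ~ S (f a)]).
  by apply: IU; move: If; rewrite /in_slalom -{1}[X in I X]setCK.
apply: filterS (filterI Udom Unbad) => a [].
rewrite /dom /slalom_rel /=; case: (phi a) => [S _ nbad|]; last by rewrite eqxx.
by exists S => //; apply: contrapT => nS; apply: nbad; exists S.
Qed.

Lemma dominating_slalom_ge h (A : set (K -> option (set K))) :
    (forall a, seg (h a) #<= seg (id_plus a)) ->
  dominating_family I h A -> [set: set K] #<= A.
Proof.
move=> hle [Ah Adom]; apply: (dominating_ge woK segK uncountableK nU).
  move=> phi /Ah[_ phih] a; apply: slalom_rel_le => S /phih.
  by rewrite card_eq_le => /andP[/card_le_trans + _]; apply.
by move=> f; have [phi Aphi fphi] := Adom f; exists phi => //;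
  exact: slalom_capture (Ah _ Aphi) fphi.
Qed.

(** The condition [a <= h a] makes [seg (h a)] nonempty for every [a] but the
    least one, so a slalom through a given function can be defined there. *)
Lemma d_slalom_powerset h :
    (forall a, a <= h a) -> (forall a, seg (h a) #<= seg (id_plus a)) ->
  d_slalom I h [set: set K].
Proof.
move=> hge hle; split; last by move=> A; exact: dominating_slalom_ge.
have /choice[sl slP] : forall ab : K * K, exists o : option (set K),
    (seg ab.2 !=set0 -> exists2 S, o = Some S & S ab.1) /\
    forall S, o = Some S -> S #= seg ab.2.
  move=> [a b] /=; have [segb|nsegb] := pselect (seg b !=set0).
    have [S Sa Sb] := card_eq_containing a segb.
    by exists (Some S); split=> [|_ [<-]//]; exists S.
  by exists None; split.
pose phi (f : K -> K) a := sl (f a, h a).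
have slalom_phi f : slalom h (phi f).
  split; last by move=> a S /(slP _).2.
  have [x _] := card_inhabited uncountableK; exists x => a /=.
  apply: contraPP => /negP; rewrite -ltNge => xa.
  have [|S + _] := (slP (f a, h a)).1; first by exists x; exact: lt_le_trans (hge a).
  by rewrite /dom /phi /= => ->; apply.
have domA : dominating_family I h (range phi).
  split=> [_ [f _ <-]//|f]; exists (phi f); first by exists f.
  apply: HbI.
  have [x _] := card_inhabited uncountableK; exists x => a /= [S].
  move=> phiS nS; rewrite leNgt; apply/negP => xa; apply: nS.
  have [|S' + S'f] := (slP (f a, h a)).1.
    by exists x; exact: lt_le_trans (hge a).
  by rewrite -/(phi f a) phiS => -[->].
exists (range phi) => //; rewrite card_eq_le; apply/andP; split; last first.
  exact: dominating_slalom_ge domA.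
apply: card_le_trans (card_image_le _ _) _; apply: card_fun_le_powerset.
exact: infinite_card.
Qed.

(** If [i] indexes [F] by kappa, the slalom [phi a = seg a + {f a | i f < a}]
    captures each [f] beyond [i f].  Adding [seg a] makes the size exactly
    [|a|] when [a] is infinite; [phi] is undefined at the finite [a]. *)
Lemma unbounded_gt F : unbounded_family I id F -> ~ (F #<= [set: K]).
Proof.
move=> unbF FK; have [x0 _] := card_inhabited uncountableK.
have [i _ iinj] := card_le_fun FK x0.
pose Phi (a : K) : set K := seg a `|` [set f a | f in [set f | F f /\ i f < a]].
have Phi_eq a : infinite_set (seg a) -> Phi a #= seg a.
  move=> infa; rewrite card_eq_le; apply/andP; split; last first.
    by apply: subset_card_le => x xa; left.
  apply: card_leU => //; first exact: card_setXid.
  apply: card_le_trans (card_image_le _ _) _.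
  apply: (card_le_rel (R := fun f b => b = i f)) => [f [_ ifa]|].
    by exists (i f).
  by move=> f g b [Ff _] [Fg _] ->; exact: iinj.
pose phi a := if pselect (infinite_set (seg a)) then Some (Phi a) else None.
have [|f Ff nf] := unbF phi; last first.
- apply: nf; apply: HbI; exists (i f) => a /= [S]; rewrite /phi.
  case: pselect => // _ [<-] nPhi; rewrite leNgt; apply/negP => ifa.
  by apply: nPhi; right; exists f.
- split=> [|a S]; last by rewrite /phi; case: pselect => // infa [<-]; exact: Phi_eq.
  have [a0 inf0] := exists_infinite_seg woK uncountableK.
  exists a0 => a; rewrite /dom /= /phi; case: pselect => //= nainf _.
  rewrite leNgt; apply/negP => a0a; apply: nainf.
  by apply: sub_infinite_set inf0 => x xa0; exact: lt_trans a0a.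
Qed.

(** The functions coding a family of kappa^+ subsets are unbounded, as a slalom
    of width [|a|] captures at most kappa of them. *)
Lemma b_slalom_succ :
  exists2 C : set (set K), succ_card [set: K] C & b_slalom I id C.
Proof.
have [C nC Cmin] := exists_card_succ (@cantor K).
exists C.
  by split=> [|D [_ nD]]; [exact: card_nle|exact: Cmin].
split; last by move=> F /unbounded_gt; exact: Cmin.
have [c cP] := exists_code segK uncountableK nU.
pose code X := c^~ X.
exists (code @` C); last first.
  apply: inj_card_eq => X Y _ _ XY.
  apply: (code_agree segK uncountableK nU cP).
  by rewrite (_ : [set a | _] = setT);
    [exact: filterT|apply/seteqP; split=> // a _; exact: (congr1 (@^~ a) XY)].
move=> phi sphi; apply: contrapT => bounded; apply: nC.
have rel_le a : slalom_rel phi a #<= seg a.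
  apply: slalom_rel_le => S /(sphi.2).
  by rewrite card_eq_le => /andP[].
apply: card_le_trans (captured_le_seg segK uncountableK nU cP rel_le).
apply: subset_card_le => X CX; apply: (slalom_capture sphi (f := code X)).
by apply: contrapT => nX; apply: bounded; exists (code X) => //; exists X.
Qed.

End Slaloms.

Theorem corollary3p5 (d : Order.disp_t) (K : orderType d)
    (HK : uncountable_cardinal K)
    (I : set (set K)) (HI : ideal I) (HbI : bounded_ideal `<=` I)
    (HU : exists2 U : set (set K), normal_ultrafilter U & dual_filter I `<=` U) :
  [/\ d_slalom I id [set: set K],
      exists2 C : set (set K), succ_card [set: K] C & b_slalom I id C
    & d_slalom I id_plus [set: set K]].
Proof.
have [U nU IU] := HU; have [/well_order_strict woK segK uncK] := HK.
have {}woK : well_orders [set: K] (fun x y => x < y).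
  rewrite (_ : (fun x y : K => is_true (x < y)) = (fun x y => is_true (~~ (y <= x))))//.
  by apply/funext => x; apply/funext => y; rewrite ltNge.
split.
- by apply: (d_slalom_powerset woK segK uncK HbI nU IU) => // a; exact: seg_id_plus.
- exact: (b_slalom_succ woK segK uncK HbI nU IU).
- by apply: (d_slalom_powerset woK segK uncK HbI nU IU) => // a; exact: id_plus_ge.
Qed.
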